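(* Let $m\geq 1$ and let $G$ be an empty (edgeless) graph with $m$ vertices. For any finite simple graph $H$, the lexicographic product $G\circ H$ is well-f-covered if and only if $H$ is well-f-covered; moreover, $f(G\circ H)=m\,f(H)$.
   Context: All graphs are finite and simple. An empty graph is a graph with no edges. The lexicographic product $G\circ H$ has vertex set $V(G)\times V(H)$, with $(g,h)$ adjacent to $(g',h')$ if and only if either $g$ is adjacent to $g'$ in $G$, or $g=g'$ and $h$ is adjacent to $h'$ in $H$. A forest in a graph $G$ means an induced subgraph $G[X]$ ($X\subseteq V(G)$) containing no cycle; it is a maximal forest if no vertex set properly containing $X$ induces an acyclic subgraph. The forest number $f(G)$ is the maximum order of a forest in $G$. A graph is well-f-covered if all its maximal forests have the same order (necessarily $f(G)$). *)

(* Defs.v *)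
From mathcomp Require Import all_boot.

Set Implicit Arguments.
Unset Strict Implicit.
Unset Printing Implicit Defensive.

Record sgraph := SGraph {
  vertex :> finType;
  adj : rel vertex;
  adj_sym : symmetric adj;
  adj_irr : irreflexive adj
}.

Definition edgeless (G : sgraph) : Prop := forall x y : G, ~~ adj x y.

Section Lex.
Variables G H : sgraph.

Definition lex_adj : rel (G * H) :=
  [rel p q | adj p.1 q.1 || (p.1 == q.1) && adj p.2 q.2].

Lemma lex_adj_sym : symmetric lex_adj.
Proof.
move=> p q; rewrite /lex_adj /=.
by rewrite (adj_sym p.1) eq_sym (adj_sym p.2).
Qed.

Lemma lex_adj_irr : irreflexive lex_adj.
Proof. by move=> p; rewrite /lex_adj /= !adj_irr andbF. Qed.

Definition lex_product : sgraph := SGraph lex_adj_sym lex_adj_irr.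

End Lex.

Section Induced.
Variables (G : sgraph) (X : {set G}).

Definition induced_adj : rel {x : G | x \in X} :=
  [rel u v | adj (val u) (val v)].

Lemma induced_adj_sym : symmetric induced_adj.
Proof. by move=> u v; apply: adj_sym. Qed.

Lemma induced_adj_irr : irreflexive induced_adj.
Proof. by move=> u; apply: adj_irr. Qed.

Definition induced : sgraph := SGraph induced_adj_sym induced_adj_irr.

End Induced.

(* The cyclic sequence of the vertices of a cycle. Without the length
   condition the empty sequence and the sequence [:: x; y] of the ends of an
   edge would also qualify. *)
Definition is_cycle (G : sgraph) (c : seq G) : bool :=
  (2 < size c) && ucycleb (@adj G) c.

(* The vertices of a cycle are distinct, so the bound on the length loses
   nothing; it makes the predicate boolean (see acyclicP). *)
Definition acyclic (G : sgraph) : bool :=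
  [forall n : 'I_#|G|.+1, forall c : n.-tuple G, ~~ is_cycle c].

Lemma acyclicP (G : sgraph) :
  reflect (forall c : seq G, ~~ is_cycle c) (acyclic G).
Proof.
apply: (iffP forallP) => [acG c | acG n]; last by apply/forallP => c.
apply/negP => cycc; have /andP[_ /andP[_ Uc]] := cycc.
have szc : size c < #|G|.+1.
  by rewrite ltnS -(card_uniqP Uc) max_card.
by have /forallP/(_ (in_tuple c))/negP := acG (Ordinal szc); apply.
Qed.

Definition is_forest (G : sgraph) (X : {set G}) : bool := acyclic (induced X).

Definition maximal_forest (G : sgraph) (X : {set G}) : bool :=
  maxset (@is_forest G) X.

Definition forest_number (G : sgraph) : nat :=
  \max_(X : {set G} | is_forest X) #|X|.

Definition well_f_covered (G : sgraph) : Prop :=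
  forall X Y : {set G}, maximal_forest X -> maximal_forest Y -> #|X| = #|Y|.

(* Main.v *)
(** Over an edgeless graph [G] the product is a disjoint union of [#|G|] copies
    of [H], one for each first coordinate.  A cycle is connected, hence stays
    in one copy, so a vertex set is a (maximal) forest exactly when its trace
    on each copy is one, and orders add up over the copies. *)
Require Import Defs.
From mathcomp Require Import all_boot.

Set Implicit Arguments.
Unset Strict Implicit.
Unset Printing Implicit Defensive.

(** Serves both for the inclusion [val] of an induced subgraph and for the embedding [pair g] of [H]
    as one copy in the product. *)
Lemma is_cycle_map (G H : sgraph) (f : G -> H) (c : seq G) :
  injective f -> {mono f : x y / adj x y} -> is_cycle (map f c) = is_cycle c.
Proof.
move=> f_inj f_mono; rewrite /is_cycle /ucycleb size_map (map_inj_uniq f_inj).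
by rewrite cycle_map (eq_cycle (e' := @adj G)).
Qed.

(** Transports cycles along [val], so that later arguments deal with sequences in [G] rather than in
    the subtype [induced X]. *)
Lemma is_forestP (G : sgraph) (X : {set G}) :
  reflect (forall c : seq G, {subset c <= X} -> ~~ is_cycle c) (is_forest X).
Proof.
have val_cycle (c : seq (induced X)) : is_cycle (map val c : seq G) = is_cycle c.
  by apply: (@is_cycle_map (induced X) G val) => //; apply: val_inj.
apply: (iffP (acyclicP _)) => [acX c cX | acX c].
  have /allP/all_sigP[c' ->] := cX.
  by rewrite val_cycle; apply: acX.
rewrite -val_cycle; apply: acX => _ /mapP[x _ ->]; exact: valP.
Qed.

Lemma is_forest0 (G : sgraph) : is_forest (set0 : {set G}).
Proof. by apply/is_forestP => [[|x c]] // /(_ x (mem_head _ _)); rewrite inE. Qed.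

Lemma forest_number_ge (G : sgraph) (X : {set G}) :
  is_forest X -> #|X| <= forest_number G.
Proof. exact: leq_bigmax_cond. Qed.

Lemma forest_number_attained (G : sgraph) :
  exists2 X : {set G}, is_forest X & #|X| = forest_number G.
Proof.
have [|X fX eqX] := @eq_bigmax_cond _ (@is_forest G) (fun X => #|X|).
  (* The maximum ranges over a nonempty family, hence is attained. *)
  by apply/card_gt0P; exists set0; apply: is_forest0.
by exists X; rewrite // /forest_number eqX.
Qed.

Section EdgelessLex.
Variables G H : sgraph.
Hypothesis edgelessG : edgeless G.
Implicit Types (X Y : {set lex_product G H}) (F : G -> {set H}).

Definition fiber X (g : G) : {set H} := [set h | (g, h) \in X].

(** Inverse to [fiber], by [glueK] and [eq_fiber]: the fibers of a set can be prescribed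
    independently. *)
Definition glue F : {set lex_product G H} := [set p : G * H | p.2 \in F p.1].

Lemma glueK F g : fiber (glue F) g = F g.
Proof. by apply/setP => h; rewrite !inE. Qed.

Lemma eq_fiber X Y : fiber X =1 fiber Y -> X = Y.
Proof. by move=> eqXY; apply/setP => -[g h]; have /setP/(_ h) := eqXY g; rewrite !inE. Qed.

Lemma fiberS X Y g : X \subset Y -> fiber X g \subset fiber Y g.
Proof. by move=> /subsetP sXY; apply/subsetP => h; rewrite !inE; apply: sXY. Qed.

Lemma card_fiber X : #|X| = \sum_g #|fiber X g|.
Proof.
rewrite -sum1_card.
rewrite (eq_bigr (fun g => \sum_(h in fiber X g) 1)) => [|g _]; last by rewrite sum1_card.
rewrite pair_big_dep /=.
by apply: eq_bigl => -[g h]; rewrite inE.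
Qed.

Lemma card_glue_const (A : {set H}) : #|glue (fun=> A)| = #|G| * #|A|.
Proof.
rewrite card_fiber (eq_bigr (fun=> #|A|)) => [|g _]; last by rewrite glueK.
by rewrite sum_nat_const.
Qed.

Lemma adj_edgeless_lex (p q : lex_product G H) :
  adj p q = (p.1 == q.1) && adj p.2 q.2.
Proof. by rewrite /= /lex_adj /= (negbTE (edgelessG _ _)). Qed.

(** Each edge preserves the first coordinate, so a path stays in the copy where it starts. *)
Lemma path_edgeless_lex (p : lex_product G H) (c : seq (lex_product G H)) :
  path (@adj _) p c -> all (fun q : lex_product G H => q.1 == p.1) c.
Proof.
elim: c p => //= q c IHc p /andP[pq /IHc].
by move: pq; rewrite /lex_adj /= (negbTE (edgelessG _ _)) => /andP[/eqP-> _] ->; rewrite eqxx.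
Qed.

Lemma is_cycle_pair (g : G) (c : seq H) :
  is_cycle ([seq (g, h) | h <- c] : seq (lex_product G H)) = is_cycle c.
Proof.
apply: (@is_cycle_map H (lex_product G H) (pair g)) => [x y [] // | x y].
by rewrite adj_edgeless_lex eqxx.
Qed.

Lemma is_forest_fiber X : is_forest X <-> forall g, is_forest (fiber X g).
Proof.
split=> [/is_forestP fX g | fX].
  apply/is_forestP => c cX; rewrite -(is_cycle_pair g); apply: fX.
  by move=> _ /mapP[h /cX + ->]; rewrite inE.
apply/is_forestP => -[|p c] // cX; apply/negP => cyc.
have /andP[_ /andP[]] := cyc.
rewrite /cycle => /path_edgeless_lex; rewrite all_rcons => /andP[_ /allP c1] _.
(* The whole cycle lies over [p.1], so it is the copy of its second projection, which is then a
   cycle in the fiber over [p.1]. *)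
have def_c : p :: c = [seq (p.1, h) | h <- [seq q.2 | q : G * H <- p :: c]].
  rewrite -map_comp -[LHS]map_id; apply/eq_in_map => -[g h] /=.
  by rewrite inE => /predU1P[<- // | /c1 /eqP <-].
have /is_forestP/(_ [seq q.2 | q : G * H <- p :: c]) := fX p.1.
rewrite -(is_cycle_pair p.1) -def_c cyc => /(_ _)/negP[] //.
move=> h ch; rewrite inE; apply: cX; rewrite def_c; exact: map_f.
Qed.

Lemma maximal_forest_fiber X :
  maximal_forest X <-> forall g, maximal_forest (fiber X g).
Proof.
split=> [/maxsetP[/is_forest_fiber fX maxX] g | maxX].
  apply/maxsetP; split=> // B fB sXB.
  (* Enlarging only the fiber over [g] to [B] gives a forest containing [X]; maximality of [X] makes
     the two equal, and their fibers over [g] show that [B] is [fiber X g]. *)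
  pose F g' := if g' == g then B else fiber X g'.
  suff /(congr1 (fiber^~ g)) : glue F = X by rewrite glueK /F eqxx.
  apply: maxX; first by apply/is_forest_fiber => g'; rewrite glueK /F; case: eqP.
  apply/subsetP => -[g' h] Xp; rewrite inE /F /=.
  case: eqP => [eg | _]; last by rewrite inE.
  by apply: (subsetP sXB); rewrite inE -eg.
apply/maxsetP; split=> [|Y /is_forest_fiber fY sXY].
  by apply/is_forest_fiber => g; have /maxsetp := maxX g.
apply: eq_fiber => g; have /maxsetP[_] := maxX g; apply=> //; exact: fiberS.
Qed.

Lemma well_f_covered_edgeless_lex :
  0 < #|G| -> well_f_covered (lex_product G H) <-> well_f_covered H.
Proof.
move=> G_gt0; split=> [wGH A B maxA maxB | wH X Y].
  (* Repeating [A], respectively [B], in every copy gives maximal forests of the product; their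
     equal orders are then divided by the positive [#|G|]. *)
  apply/eqP; rewrite -(eqn_pmul2l G_gt0) -!card_glue_const; apply/eqP.
  by apply: wGH; apply/maximal_forest_fiber => g; rewrite glueK.
move=> /maximal_forest_fiber maxX /maximal_forest_fiber maxY.
by rewrite !card_fiber; apply: eq_bigr => g _; apply: wH.
Qed.

Lemma forest_number_edgeless_lex :
  forest_number (lex_product G H) = #|G| * forest_number H.
Proof.
apply/eqP; rewrite eqn_leq; apply/andP; split.
  (* Upper bound: each of the [#|G|] fibers is a forest of [H]. *)
  apply/bigmax_leqP => X /is_forest_fiber fX.
  rewrite card_fiber -sum_nat_const; apply: leq_sum => g _.
  exact: forest_number_ge.
(* Lower bound: a maximum forest of [H] is repeated in every copy. *)
have [A fA <-] := forest_number_attained H.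
rewrite -card_glue_const; apply: forest_number_ge.
by apply/is_forest_fiber => g; rewrite glueK.
Qed.

End EdgelessLex.

Theorem theorem3p1 (m : nat) (hm : 1 <= m) (G H : sgraph)
  (hG : #|G| = m) (hGe : edgeless G) :
  (well_f_covered (lex_product G H) <-> well_f_covered H) /\
  forest_number (lex_product G H) = m * forest_number H.
Proof.
rewrite -hG in hm *; split; first exact: well_f_covered_edgeless_lex.
exact: forest_number_edgeless_lex.
Qed.
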